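(* Let $X$ be a Cantor space and let $\mu$ be a good measure in $M^0_\infty(X)$. Then the group $H_\mu(X)$ acts transitively on $X\setminus\mathfrak{M}_\mu$, i.e. for every $x_1,x_2\in X\setminus\mathfrak{M}_\mu$ there exists $h\in H_\mu(X)$ with $h(x_1)=x_2$. In particular, $H_\mu(X)$ acts topologically transitively on $X$.
   Context: A Cantor space is a non-empty zero-dimensional compact perfect metric space. A Borel measure on a Cantor space $X$ is full if every non-empty open set has positive measure. $M_\infty(X)$ is the set of all full non-atomic Borel measures $\mu$ on $X$ with $\mu(X)=\infty$. For $\mu\in M_\infty(X)$ the defective set is $\mathfrak{M}_\mu=\{x\in X:\mu(U)=\infty\text{ for every clopen }U\ni x\}$, and $M^0_\infty(X)=\{\mu\in M_\infty(X):\mu(\mathfrak{M}_\mu)=0\}$. A measure $\mu\in M^0_\infty(X)$ is good if whenever $U,V$ are clopen subsets of $X$ with $\mu(U)<\mu(V)$, there is a clopen $W\subset V$ with $\mu(W)=\mu(U)$. $H_\mu(X)$ is the group of self-homeomorphisms of $X$ preserving $\mu$. The action of $H_\mu(X)$ on $X$ is topologically transitive if there is $x\in X$ such that the orbit $O(x)=\{h(x):h\in H_\mu(X)\}$ is dense in $X$. *)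

(* Defs.v *)
From HB Require Import structures.
From mathcomp Require Import all_boot all_order all_algebra.
From mathcomp Require Import all_classical all_reals all_analysis.

Set Implicit Arguments.
Unset Strict Implicit.
Unset Printing Implicit Defensive.

Import Order.TTheory GRing.Theory Num.Theory.

Local Open Scope classical_set_scope.
Local Open Scope ring_scope.

(* Non-empty metric spaces.  The library builds [measurableType] on top of
   [pointedType], so non-emptiness is carried by a base point. *)
#[short(type="pmetricType")]
HB.structure Definition PointedMetric (K : numDomainType) :=
  {T of Pointed T & Metric K T}.

Notation borel X := (g_sigma_algebraType (@open X)).
Notation borel_measure R X := {measure set (borel X) -> \bar R}.

Section Measures.
Local Open Scope ereal_scope.
Context {R : realType} {X : ptopologicalType}.
Implicit Types (mu : borel_measure R X) (A B : set (borel X)) (U V W : set X).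

Definition full_measure mu := forall U, open U -> U !=set0 -> 0 < mu U.

(* On a measure that may take the value +oo, this does not ask atoms to have
   finite measure: a point of infinite mass is an atom. *)
Definition atom mu A :=
  [/\ measurable A, 0 < mu A &
      forall B, measurable B -> B `<=` A -> mu B = 0 \/ mu (A `\` B) = 0].

Definition non_atomic mu := forall A, ~ atom mu A.

Definition M_infty : set (borel_measure R X) :=
  [set mu | [/\ full_measure mu, non_atomic mu & mu [set: X] = +oo]].

(* This set is closed, hence Borel. *)
Definition defective_set mu : set X :=
  [set x | forall U, clopen U -> U x -> mu U = +oo].

Definition M0_infty : set (borel_measure R X) :=
  [set mu | M_infty mu /\ mu (defective_set mu) = 0].

Definition good mu := forall U V, clopen U -> clopen V -> mu U < mu V ->
  exists W, [/\ clopen W, W `<=` V & mu W = mu U].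

Definition measure_preserving mu (h : X -> X) :=
  forall A, measurable A -> mu (h @^-1` A) = mu A.

End Measures.

Definition homeomorphism (X Y : topologicalType) (h : X -> Y) :=
  exists g : Y -> X,
    [/\ cancel h g, cancel g h, continuous h & continuous g].

Definition H_group (R : realType) (X : ptopologicalType)
    (mu : borel_measure R X) : set (X -> X) :=
  [set h | homeomorphism h /\ measure_preserving mu h].

Definition orbit_of (X : Type) (G : set (X -> X)) (x : X) : set X :=
  [set h x | h in G].

Definition topologically_transitive (X : topologicalType)
    (G : set (X -> X)) := exists x : X, dense (orbit_of G x).

(* Main.v *)
(* Let x <> y be non-defective. Goodness gives disjoint clopen sets U and V of
   equal finite measure with x in U and y in V. A back-and-forth argument along
   an enumeration of the clopen sets builds clopen sets D_n whose traces exhaust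
   the clopen subsets of U and of V, and such that every cell of the partition
   generated by finitely many D_n meets U and V in the same measure; the cell of
   x is always that of y. At each step goodness only gives a clopen set of the
   right measure; it can be made to contain y by trading a small neighbourhood
   of y against a subset of the same measure, as points have measure zero.
   Fullness and compactness then pair each point of U with exactly one point of
   V lying in the same sets D_n. Exchanging paired points and fixing everything
   outside U and V is a homeomorphism, an involution, and it preserves the
   measure of clopen sets inside U and V, hence of all Borel sets.
   Non-defective points are dense, since the defective set is null and the
   measure is full. *)
Require Import Defs.
From HB Require Import structures.
From mathcomp Require Import all_boot all_order all_algebra.
From mathcomp Require Import all_classical all_reals all_analysis.

Set Implicit Arguments.
Unset Strict Implicit.
Unset Printing Implicit Defensive.

Import Order.TTheory GRing.Theory Num.Theory.

Local Open Scope classical_set_scope.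

(** * Clopen sets, compactness and continuity *)

Lemma clopenD (T : topologicalType) (U V : set T) :
  clopen U -> clopen V -> clopen (U `\` V).
Proof. by move=> cU cV; rewrite setDE; apply: clopenI => //; exact: clopenC. Qed.

(** A cluster point of the filter generated by the [E n] lies in the closure of each of them, hence
    in each. *)
Lemma compact_bigcap_nonincreasing (T : topologicalType) (E : (set T)^nat) :
  compact [set: T] -> (forall n, closed (E n)) -> (forall n, E n !=set0) ->
  {homo E : n m / (n <= m)%N >-> (m <= n)%O} -> \bigcap_n E n !=set0.
Proof.
move=> cT cE E0 ndE; pose F := filter_from [set: nat] E.
have FF : Filter F.
  apply: filter_from_filter; first by exists 0%N.
  move=> i j _ _; exists (maxn i j) => // x Ex; split.
    by have /subsetPset := ndE _ _ (leq_maxl i j); exact.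
  by have /subsetPset := ndE _ _ (leq_maxr i j); exact.
have PF : ProperFilter F by apply: filter_from_proper => i _; exact: E0.
have [|x [_ xF]] := cT F PF; first exact: filterT.
exists x => n _; rewrite ((closure_id (E n)).1 (cE n)) => B xB.
by apply: xF => //; exists n.
Qed.

Lemma continuous_clopen (T S : topologicalType) (h : T -> S) :
  hausdorff_space S -> zero_dimensional S -> compact [set: S] ->
  (forall U, clopen U -> clopen (h @^-1` U)) -> continuous h.
Proof.
move=> hS zS cS hcl x B /= /(zero_dimensional_cvg hS zS cS)[U [Uhx cU]] UB.
have [oU _] := hcl _ cU.
by apply: filterS (open_nbhs_nbhs (conj oU Uhx)) => y; exact: UB.
Qed.

(** * Borel measures and their values on clopen sets *)

Section BorelMeasure.
Context {R : realType} {X : ptopologicalType} (mu : borel_measure R X).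
Implicit Types U V W A B C D : set X.
Local Open Scope ereal_scope.

Lemma open_borel U : open U -> measurable (U : set (borel X)).
Proof. exact: sub_sigma_algebra. Qed.

Lemma closed_borel U : closed U -> measurable (U : set (borel X)).
Proof. by move=> cU; rewrite -(setCK U); apply: measurableC (open_borel (closed_openC cU)). Qed.

Lemma clopen_borel U : clopen U -> measurable (U : set (borel X)).
Proof. by case=> oU _; exact: open_borel. Qed.

Lemma measure_clopenID U V : clopen U -> clopen V ->
  mu U = mu (U `&` V) + mu (U `\` V).
Proof. by move=> cU cV; rewrite addeC -measureDI//; exact: clopen_borel. Qed.

Lemma sub_measure_clopen U V : clopen U -> clopen V -> U `<=` V -> mu U <= mu V.
Proof. by move=> cU cV UV; apply: le_measure; rewrite ?inE//; exact: clopen_borel. Qed.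

Lemma measure_clopenD_eq U V A B : clopen U -> clopen V -> clopen A -> clopen B ->
  A `<=` U -> B `<=` V -> mu U < +oo -> mu U = mu V -> mu A = mu B ->
  mu (U `\` A) = mu (V `\` B).
Proof.
move=> cU cV cA cB AU BV Uoo UV AB.
have mD W C : clopen W -> clopen C -> C `<=` W -> mu W < +oo ->
    mu (W `\` C) = mu W - mu C.
  by move=> cW cC CW Woo; rewrite measureD ?setIidr//; exact: clopen_borel.
by rewrite !mD -?UV ?AB.
Qed.

(** Clopen sets are stable under intersection and generate the Borel sets: being a countable base,
    they give each open set as a countable union. Finite mass then allows uniqueness of measures. *)
Lemma measure_eq_clopen (C : (set X)^nat) (m1 m2 : borel_measure R X) :
  hausdorff_space X -> zero_dimensional X -> compact [set: X] ->
  range C = @clopen X -> m1 [set: X] < +oo ->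
  (forall U, clopen U -> m1 U = m2 U) ->
  forall A, measurable (A : set (borel X)) -> m1 A = m2 A.
Proof.
move=> hX zX cX rC foo m12.
apply: (measure_unique (@clopen X : set (set (borel X))) (fun=> setT)).
- apply/seteqP; split; last first.
    apply: smallest_sub => //; first exact: sigma_algebra_measurable.
    by move=> U cU; exact: clopen_borel.
  apply: smallest_sub; first exact: smallest_sigma_algebra.
  move=> U oU.
  have -> : U = \bigcup_(n in [set n | C n `<=` U]) C n.
    apply/seteqP; split=> [x Ux|x [n /= CnU]]; last exact: CnU.
    have [V [Vx cV] VU] :=
      zero_dimensional_cvg hX zX cX (open_nbhs_nbhs (conj oU Ux)).
    by move: cV; rewrite -rC => -[n _ nV]; exists n; rewrite /= nV.
  apply: (@bigcup_measurable _ (g_sigma_algebraType (@clopen X))) => n _.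
  by apply: sub_sigma_algebra; rewrite -rC; exists n.
- exact: clopenI.
- by move=> _; exact: clopenT.
- by rewrite bigcup_const.
- exact: m12.
- by move=> _.
Qed.

End BorelMeasure.

(** * Small neighbourhoods, and goodness with a prescribed point *)

Section GoodMeasure.
Context {R : realType} {X : ptopologicalType} (mu : borel_measure R X).
Implicit Types U V W A B D N : set X.
Local Open Scope ereal_scope.
Variable C : (set X)^nat.
Hypothesis rC : range C = @clopen X.
Hypotheses (hX : hausdorff_space X) (zX : zero_dimensional X)
  (cX : compact [set: X]).
Hypotheses (mu_full : full_measure mu) (mu_na : non_atomic mu)
  (mu_good : good mu).

Let cC n : clopen (C n). Proof. by rewrite -rC; exists n. Qed.

(** The only subsets of a singleton are itself and the empty set, so positive mass, even infinite,
    would make it an atom. *)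
Lemma measure_set1 x : mu [set x] = 0.
Proof.
apply/eqP; rewrite eq_le measure_ge0 andbT leNgt; apply/negP => mux.
apply: (mu_na (A := [set x])); split=> //.
  by apply: closed_borel; apply: accessible_closed_set1; exact: hausdorff_accessible.
move=> B _ Bx; have [Bx'|Bx'] := pselect (B x); [right|left].
  by rewrite (_ : [set x] `\` B = set0) ?measure0// setD_eq0 => _ ->.
rewrite (_ : B = set0) ?measure0// -subset0 => y By.
by apply: Bx'; rewrite -(Bx _ By).
Qed.

Lemma small_clopen_nbhs U x e : clopen U -> U x -> mu U < +oo -> 0 < e ->
  exists N, [/\ clopen N, N `<=` U, N x & mu N < e].
Proof.
move=> cU Ux Uoo e0; apply: contrapT => noN.
(* [K i] is whichever of [C i] and its complement contains [x]. Clopen sets separate points, so the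
   [E n] shrink to [x] alone. *)
pose K i := if `[< C i x >] then C i else ~` C i.
have cK i : clopen (K i) by rewrite /K; case: ifP => _; [|apply: clopenC].
have Kx i : K i x by rewrite /K; case: asboolP.
pose E n := U `&` \big[setI/setT]_(i < n) K i.
have cE n : clopen (E n).
  apply: clopenI => //; elim/big_ind : _ => //; first exact: clopenT.
  by move=> A B; exact: clopenI.
have Ex n : E n x by split=> //; elim/big_ind : _ => //.
have capE : \bigcap_n E n = [set x].
  apply/seteqP; split=> [y Ey|_ -> n _//] /=; apply: contrapT => /eqP yx.
  have [V [cV Vy Vx]] := zX yx.
  move: cV; rewrite -rC => -[n _ nV].
  (* [E n] involves only the [K i] with [i < n], so [K n] first enters in [E n.+1]. *)
  have [_] := Ey n.+1 Logic.I; rewrite big_ord_recr/= => -[_].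
  by rewrite /K nV; case: asboolP.
have Emu : mu \o E @ \oo --> 0.
  rewrite -(measure_set1 x) -capE; apply: nonincreasing_cvg_mu.
  - by apply: le_lt_trans Uoo; apply: sub_measure_clopen => // y [].
  - by move=> n; exact: clopen_borel.
  - by apply: bigcap_measurable => // n _; exact: clopen_borel.
  - apply/nonincreasing_seqP => n; apply/subsetPset => y.
    by rewrite /E big_ord_recr/= => -[Uy []].
have : e <= 0.
  rewrite -(cvg_lim _ Emu)//; apply: lime_ge; first by apply/cvg_ex; exists 0.
  near=> n; rewrite leNgt; apply/negP => nE; apply: noN.
  by exists (E n); split=> // y [].
by rewrite leNgt e0.
Unshelve. all: by end_near. Qed.

Lemma good_le U V : clopen U -> clopen V -> mu U <= mu V ->
  exists W, [/\ clopen W, W `<=` V & mu W = mu U].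
Proof.
move=> cU cV; rewrite le_eqVlt => /predU1P[UV|]; first by exists V; split.
exact: mu_good.
Qed.

Lemma good_le_pt U V x : clopen U -> clopen V -> U !=set0 -> V x ->
  mu V < +oo -> mu U <= mu V ->
  exists W, [/\ clopen W, W `<=` V, W x & mu W = mu U].
Proof.
move=> cU cV U0 Vx Voo UV.
have [W [cW WV WU]] := good_le cU cV UV.
have [Wx|nWx] := pselect (W x); first by exists W.
(* [mu W] is positive because [U] is non-empty and [mu] is full, so some neighbourhood [N] of [x] is
   lighter than [W] and can replace a part [M] of it. *)
have [N [cN NVW Nx NU]] : exists N,
    [/\ clopen N, N `<=` V `\` W, N x & mu N < mu W].
  have cVW := clopenD cV cW; apply: small_clopen_nbhs => //.
    by apply: le_lt_trans Voo; apply: sub_measure_clopen => // z [].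
  by rewrite WU; apply: mu_full => //; case: cU.
have [M [cM MW MN]] := mu_good cN cW NU.
exists ((W `\` M) `|` N); split.
- by apply: clopenU => //; exact: clopenD.
- by move=> y [[/WV]|/NVW[]].
- by right.
rewrite measureU; last first.
- by rewrite -subset0 => y [[Wy _] /NVW[_]].
- exact: clopen_borel.
- by apply: clopen_borel; exact: clopenD.
rewrite -WU (measure_clopenID mu cW cM) (setIidr MW) MN.
by rewrite addeC.
Qed.

Lemma good_pointed U V A x y : clopen U -> clopen V -> clopen A -> A `<=` U ->
  mu U < +oo -> mu U = mu V -> (U x <-> V y) ->
  exists D, [/\ clopen D, D `<=` V, mu A = mu D & (A x <-> D y)].
Proof.
move=> cU cV cA AU Uoo UV xy.
have Voo : mu V < +oo by rewrite -UV.
have AV : mu A <= mu V by rewrite -UV; exact: sub_measure_clopen.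
have [Ax|nAx] := pselect (A x).
  have [||D [cD DV Dy DA]] := @good_le_pt A V y cA cV _ _ Voo AV.
  - by exists x.
  - exact/xy/AU.
  - by exists D.
(* When [x] is in [U] but not in [A], the complement of [A] in [U] is copied instead: its copy [E]
   catches [y], so the rest of [V] avoids it. *)
have [Ux|nUx] := pselect (U x).
  have cUA := clopenD cU cA.
  have [|||E [cE EV Ey EA]] := @good_le_pt (U `\` A) V y cUA cV _ _ Voo _.
  - by exists x.
  - exact/xy.
  - by rewrite -UV; apply: sub_measure_clopen => // z [].
  exists (V `\` E); split=> //; [exact: clopenD| |].
    rewrite -(@measure_clopenD_eq _ _ mu U V (U `\` A) E)//.
    by rewrite setDD setIidr.
  by split=> // -[].
have [D [cD DV DA]] := good_le cA cV AV.
by exists D; split=> //; split=> [/AU//|/DV/xy].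
Qed.

(** * Matching two clopen sets along finite partitions *)

(* On every cell of the finite partition of [X] generated by [L], [U] and [V]
   have traces of the same measure, one containing [x] iff the other contains
   [y]. Splitting one member of [L] at a time keeps the inductions structural. *)
Fixpoint matched x y (L : seq (set X)) U V : Prop :=
  if L is D :: L' then
    matched x y L' (U `&` D) (V `&` D) /\ matched x y L' (U `\` D) (V `\` D)
  else mu U = mu V /\ (U x <-> V y).

Lemma matched_sym x y L U V : matched x y L U V -> matched y x L V U.
Proof.
by elim: L U V => [|D L IH] U V /= [? ?]; split=> //; [exact: iff_sym|exact: IH..].
Qed.

Lemma matched_pt x y L U V : matched x y L U V -> (U x <-> V y).
Proof.
elim: L U V => [|D L IH] U V /= []// m1 m2.
have [/= pxy pyx] := IH _ _ m1; have [/= qxy qyx] := IH _ _ m2.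
by split=> Uz; [have := pselect (D x)|have := pselect (D y)]; tauto.
Qed.

Lemma matched_measure x y L U V : (forall D, D \in L -> clopen D) ->
  clopen U -> clopen V -> matched x y L U V -> mu U = mu V.
Proof.
elim: L U V => [|D L IH] U V /= cL cU cV []// m1 m2.
have cD : clopen D by apply: cL; rewrite mem_head.
have cL' D' : D' \in L -> clopen D'.
  by move=> LD; apply: cL; rewrite in_cons LD orbT.
rewrite (measure_clopenID mu cU cD) (measure_clopenID mu cV cD).
by congr (_ + _); apply: IH => //; by [apply: clopenI|apply: clopenD].
Qed.

(** Each member of [L] cuts [A] in two; the pieces are copied into the corresponding parts of [V]
    and the copies united. Uncut cells are the case of [good_pointed]. *)
Lemma matched_extend x y L U V A : (forall D, D \in L -> clopen D) ->
  clopen U -> clopen V -> clopen A -> A `<=` U -> mu U < +oo ->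
  matched x y L U V ->
  exists D, [/\ clopen D, D `<=` V, matched x y L A D &
    matched x y L (U `\` A) (V `\` D)].
Proof.
elim: L U V A => [|D L IH] U V A /= cL cU cV cA AU Uoo [].
  move=> UV xy.
  have [D [cD DV AD Axy]] := good_pointed cU cV cA AU Uoo UV xy.
  exists D; split=> //; split; first exact: measure_clopenD_eq.
  by split=> -[/xy ? ?]; split=> // /Axy.
have cD : clopen D by apply: cL; rewrite mem_head.
have cL' D' : D' \in L -> clopen D'.
  by move=> LD; apply: cL; rewrite in_cons LD orbT.
have Woo W : clopen W -> W `<=` U -> mu W < +oo.
  by move=> cW WU; apply: le_lt_trans Uoo; exact: sub_measure_clopen.
have cI W : clopen W -> clopen (W `&` D) by move=> ?; exact: clopenI.
have cW W : clopen W -> clopen (W `\` D) by move=> ?; exact: clopenD.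
move=> /(IH _ _ (A `&` D) cL' (cI _ cU) (cI _ cV) (cI _ cA) (setSI AU)).
move=> /(_ (Woo _ (cI _ cU) (@subIsetl _ _ _)))[E1 [cE1 E1V m1 m1']].
move=> /(IH _ _ (A `\` D) cL' (cW _ cU) (cW _ cV) (cW _ cA) (setSD AU)).
move=> /(_ (Woo _ (cW _ cU) (@subDsetl _ _ _)))[E2 [cE2 E2V m2 m2']].
have E1D : E1 `<=` D by move=> z /E1V[].
have E2D z : E2 z -> ~ D z by move=> /E2V[].
have eI : (E1 `|` E2) `&` D = E1.
  apply/seteqP; split=> [z [[//|/E2D] //]|z E1z]; split; [by left|exact: E1D].
have eD : (E1 `|` E2) `\` D = E2.
  apply/seteqP; split=> [z [[/E1D|] //]|z E2z]; split; [by right|exact: E2D].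
have DDI (S T : set X) : (S `\` T) `&` D = (S `&` D) `\` (T `&` D).
  by apply/seteqP; split=> z /=; tauto.
have DDD (S T : set X) : (S `\` T) `\` D = (S `\` D) `\` (T `\` D).
  by apply/seteqP; split=> z /=; have := pselect (D z); tauto.
exists (E1 `|` E2); split.
- exact: clopenU.
- by move=> z [/E1V[]|/E2V[]].
- by rewrite eI eD.
- by rewrite !DDI !DDD eI eD.
Qed.

(** The cell of [U] around [z] is open and non-empty, hence of positive measure; the corresponding
    cell of [V] has the same measure, so it is non-empty. *)
Lemma matched_code x y L U V z : (forall D, D \in L -> clopen D) ->
  clopen U -> clopen V -> matched x y L U V -> U z ->
  exists2 t, V t & forall D, D \in L -> (D z <-> D t).
Proof.
elim: L U V => [|D L IH] U V /= cL cU cV [].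
  move=> UV _ Uz.
  have : 0 < mu V by rewrite -UV; apply: mu_full; [case: cU|exists z].
  have [->|/set0P[t Vt] _] := eqVneq V set0; last by exists t.
  by rewrite measure0 ltxx.
have cD : clopen D by apply: cL; rewrite mem_head.
have cL' D' : D' \in L -> clopen D'.
  by move=> LD; apply: cL; rewrite in_cons LD orbT.
move=> m1 m2 Uz; have [Dz|nDz] := pselect (D z).
  have [||//|t [Vt Dt] zt] := IH _ _ cL' _ _ m1; [exact: clopenI..|].
  by exists t => // D' /predU1P[->//|]; exact: zt.
have [||//|t [Vt Dt] zt] := IH _ _ cL' _ _ m2; [exact: clopenD..|].
by exists t => // D' /predU1P[->//|]; exact: zt.
Qed.

Lemma matched_code_pt x y L U V : matched x y L U V -> U x ->
  forall D, D \in L -> (D x <-> D y).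
Proof.
elim: L U V => [|D L IH] U V //= [m1 m2] Ux D' /predU1P[->|LD'].
  have [pxy pyx] := matched_pt m1; have [qxy qyx] := matched_pt m2.
  split=> Dx; first by case: pxy.
  apply: contrapT => nDx; by case: qxy.
have [Dx|nDx] := pselect (D x).
  exact: (IH _ _ m1).
exact: (IH _ _ m2).
Qed.

(** The traces of [D] are unions of corresponding cells, whose measures agree and add up. *)
Lemma matched_mem_measure x y L U V D : (forall E, E \in L -> clopen E) ->
  clopen U -> clopen V -> matched x y L U V -> D \in L ->
  mu (U `&` D) = mu (V `&` D).
Proof.
elim: L U V => [|E L IH] U V //= cL cU cV [m1 m2] DL.
have cE : clopen E by apply: cL; rewrite mem_head.
have cD := cL _ DL.
have cL' D' : D' \in L -> clopen D'.
  by move=> LD; apply: cL; rewrite in_cons LD orbT.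
have cI W : clopen W -> clopen (W `&` E) by move=> ?; exact: clopenI.
have cW W : clopen W -> clopen (W `\` E) by move=> ?; exact: clopenD.
move: DL => /predU1P[->|DL].
  by apply: (matched_measure cL' _ _ m1); exact: cI.
rewrite (measure_clopenID mu (clopenI cU cD) cE).
rewrite (measure_clopenID mu (clopenI cV cD) cE).
rewrite !(setIAC _ D) -!setIDA -!setIDAC.
by congr (_ + _); apply: IH => //; by [exact: cI|exact: cW].
Qed.

Lemma matched_add x y L U V A : (forall D, D \in L -> clopen D) ->
  clopen U -> clopen V -> U `&` V = set0 -> mu U < +oo ->
  clopen A -> matched x y L U V ->
  exists D, [/\ clopen D, matched x y (D :: L) U V & U `&` D = U `&` A].
Proof.
move=> cL cU cV UV0 Uoo cA mL.
have [E [cE EV m1 m2]] :=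
  matched_extend cL cU cV (clopenI cU cA) (@subIsetl _ _ _) Uoo mL.
have VU z : V z -> ~ U z by move=> Vz Uz; have : (U `&` V) z by []; rewrite UV0.
(* As [U] and [V] are disjoint, the trace on [V] can be chosen freely: it is the copy [E] of the
   trace of [A] on [U]. *)
exists ((U `&` A) `|` E); split=> /=.
- by apply: clopenU => //; exact: clopenI.
- have -> : U `&` (U `&` A `|` E) = U `&` A.
    by apply/seteqP; split=> z /= => [[Uz [//|/EV/VU]]|[Uz Az]] //; split=> //; left.
  have -> : V `&` (U `&` A `|` E) = E.
    apply/seteqP; split=> z /= => [[/VU nU [[]|]] //|Ez].
    by split; [exact: EV|right].
  have -> : U `\` (U `&` A `|` E) = U `\` (U `&` A).
    apply/seteqP; split=> z /= => [[Uz nz]|[Uz nz]]; split=> //; first by tauto.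
    by move=> [//|/EV/VU].
  suff -> : V `\` (U `&` A `|` E) = V `\` E by [].
  apply/seteqP; split=> z /= => [[Vz nz]|[Vz nz]]; split=> //; first by tauto.
  by move=> [[/(VU _ Vz)]|].
- by apply/seteqP; split=> z /= => [[Uz [//|/EV/VU]]|[Uz Az]] //; split=> //; left.
Qed.

(** * The back-and-forth construction *)

Lemma back_and_forth x y U V : clopen U -> clopen V -> U `&` V = set0 ->
  mu U < +oo -> mu U = mu V -> U x -> V y ->
  exists L : (seq (set X))^nat,
  [/\ forall n D, D \in L n -> clopen D,
      forall n, matched x y (L n) U V,
      forall n D, D \in L n -> D \in L n.+1,
      forall A, clopen A -> exists n D, D \in L n /\ U `&` D = U `&` A &
      forall A, clopen A -> exists n D, D \in L n /\ V `&` D = V `&` A].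
Proof.
move=> cU cV UV0 Uoo UV Ux Vy.
pose ok L := (forall D, D \in L -> clopen D) /\ matched x y L U V.
have Voo : mu V < +oo by rewrite -UV.
(* Stage [n] treats [C n] twice: one new set has its trace on [U]; another, found with [U] and [V]
   exchanged, has its trace on [V]. *)
have step (nL : nat * {L | ok L}) : {nL' : nat * {L | ok L} |
    [/\ nL'.1 = nL.1.+1,
        forall D, D \in sval nL.2 -> D \in sval nL'.2,
        exists2 D, D \in sval nL'.2 & U `&` D = U `&` C nL.1 &
        exists2 D, D \in sval nL'.2 & V `&` D = V `&` C nL.1]}.
  case: nL => n [L [cL mL]] /=; apply: cid.
  have [D [cD mD DU]] := matched_add cL cU cV UV0 Uoo (cC n) mL.
  have cDL E : E \in D :: L -> clopen E by move=> /predU1P[->|/cL].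
  have VU0 : V `&` U = set0 by rewrite setIC.
  have [D' [cD' mD' DV]] :=
    matched_add cDL cV cU VU0 Voo (cC n) (matched_sym mD).
  have okL : ok (D' :: D :: L).
    by split; [move=> E /predU1P[->|/cDL]|exact: matched_sym].
  exists (n.+1, exist _ _ okL) => /=; split=> //.
  - by move=> E LE; rewrite !in_cons LE !orbT.
  - by exists D => //; rewrite !in_cons eqxx orbT.
  - by exists D' => //; rewrite mem_head.
have ok0 : ok [::] by split.
have [f [f0 fS]] := dependent_choice step (0%N, exist _ _ ok0).
have f1 n : (f n).1 = n by elim: n => [|n IH]; [rewrite f0|have [->] := fS n; rewrite IH].
exists (fun n => sval (f n).2); split.
- by move=> n D; have [+ _] := svalP (f n).2; exact.
- by move=> n; have [] := svalP (f n).2.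
- by move=> n; have [] := fS n.
- move=> A; rewrite -rC => -[n _ <-]; exists n.+1.
  by have [_ _ [D LD DU] _] := fS n; exists D; rewrite DU f1.
- move=> A; rewrite -rC => -[n _ <-]; exists n.+1.
  by have [_ _ _ [D LD DU]] := fS n; exists D; rewrite DU f1.
Qed.

(** * Points lying in the same sets of all the lists *)

Lemma clopen_code (L : seq (set X)) z : (forall D, D \in L -> clopen D) ->
  clopen [set t | forall D, D \in L -> (D z <-> D t)].
Proof.
elim: L => [|D L IH] cL.
  rewrite (_ : mkset _ = setT); first exact: clopenT.
  by apply/seteqP; split.
pose K := if `[< D z >] then D else ~` D.
have cD : clopen D by apply: cL; rewrite mem_head.
rewrite (_ : mkset _ = K `&` [set t | forall D, D \in L -> (D z <-> D t)]).
  apply: clopenI; first by rewrite /K; case: ifP => _ //; exact: clopenC.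
  by apply: IH => E LE; apply: cL; rewrite in_cons LE orbT.
have KE t : K t <-> (D z <-> D t) by rewrite /K; case: asboolP => /= ?; tauto.
apply/seteqP; split=> t /=.
  move=> Ht; split; first by apply/KE/Ht; rewrite mem_head.
  by move=> E LE; apply: Ht; rewrite in_cons LE orbT.
by move=> [/KE Kt Ht] E /predU1P[->|]; [exact: Kt|exact: Ht].
Qed.

(** The points of [V] that agree with [z] on [L n] form non-empty closed sets decreasing in [n], so
    compactness gives a common point. *)
Lemma matched_limit_code x y (L : (seq (set X))^nat) U V z :
  clopen U -> clopen V ->
  (forall n D, D \in L n -> clopen D) ->
  (forall n, matched x y (L n) U V) ->
  (forall n D, D \in L n -> D \in L n.+1) -> U z ->
  exists2 t, V t & forall n D, D \in L n -> (D z <-> D t).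
Proof.
move=> cU cV cL mL LS Uz.
pose E n := V `&` [set t | forall D, D \in L n -> (D z <-> D t)].
have [|||t Et] := @compact_bigcap_nonincreasing _ E cX.
- by move=> n; have [] := clopenI cV (clopen_code z (cL n)).
- move=> n; have [t Vt zt] := matched_code (cL n) cU cV (mL n) Uz.
  by exists t.
- apply/nonincreasing_seqP => n; apply/subsetPset => t [Vt zt].
  by split=> // D LD; apply: zt; exact: LS.
exists t; first by have [] := Et 0%N Logic.I.
by move=> n; have [] := Et n Logic.I.
Qed.

(** * The measure-preserving exchange of two clopen sets *)

Lemma swap_homeomorphism x y U V : clopen U -> clopen V -> U `&` V = set0 ->
  mu U < +oo -> mu U = mu V -> U x -> V y ->
  exists h : X -> X, [/\ H_group mu h, h x = y & h y = x].
Proof.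
move=> cU cV UV0 Uoo UV Ux Vy.
have [L [cL mL LS LU LV]] := back_and_forth cU cV UV0 Uoo UV Ux Vy.
have disj z : U z -> V z -> False.
  by move=> Uz Vz; have : (U `&` V) z by []; rewrite UV0.
pose sim z t := forall n D, D \in L n -> (D z <-> D t).
have sim_sym z t : sim z t -> sim t z by move=> zt n D LD; apply: iff_sym; exact: zt LD.
have sim_trans z t w : sim z t -> sim t w -> sim z w.
  by move=> zt tw n D LD; apply: iff_trans (tw n D LD); exact: zt LD.
(* The lists cut out on [W] the traces of all clopen sets, and these separate the points of [W]. *)
have inj (W : set X) :
    (forall A, clopen A -> exists n D, D \in L n /\ W `&` D = W `&` A) ->
    forall t w, W t -> W w -> sim t w -> t = w.
  move=> WL t w Wt Ww tw; apply: contrapT => /eqP/zX[A [/WL[n [D [LD DA]]] At nAw]].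
  have [_ Dt] : (W `&` D) t by rewrite DA.
  have : (W `&` A) w by rewrite -DA; split=> //; exact/(tw n D LD).
  by case.
pose r z t := (U z /\ V t \/ V z /\ U t) /\ sim z t.
have r_sym z t : r z t -> r t z.
  by move=> [[[]|[]] ? ? zt]; (split; last exact: sim_sym); [right|left].
have r_fun z t w : r z t -> r z w -> t = w.
  move=> [zt1 zt] [zw1 zw]; have tw := sim_trans _ _ _ (sim_sym _ _ zt) zw.
  case: zt1 => -[Hz Ht]; case: zw1 => -[Hz' Hw].
  - exact: (inj V).
  - by have := disj z Hz Hz'.
  - by have := disj z Hz' Hz.
  - exact: (inj U).
have r_ex z : U z \/ V z -> exists t, r z t.
  move=> [Uz|Vz].
    have [t Vt zt] := matched_limit_code cU cV cL mL LS Uz.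
    by exists t; split=> //; left.
  have [t Ut zt] :=
    matched_limit_code cV cU cL (fun n => matched_sym (mL n)) LS Vz.
  by exists t; split=> //; right.
(* The default value [z] makes [h] the identity outside [U] and [V], where no point is paired. *)
pose h z := xget z (r z).
have rh z t : r z t -> h z = t.
  by move=> zt; apply: xget_unique => // w zw; exact: r_fun zt.
have hr z : U z \/ V z -> r z (h z).
  by move=> /r_ex[t zt]; rewrite (rh _ _ zt).
have hid z : ~ (U z \/ V z) -> h z = z.
  by move=> nz; apply: xgetPN => t [zt _]; apply: nz; tauto.
have hU z : U z -> V (h z).
  move=> Uz; have [[[_//]|[Vz _]] _] := hr z (or_introl Uz).
  by have := disj z Uz Vz.
have hV z : V z -> U (h z).
  move=> Vz; have [[[Uz _]|[_ //]] _] := hr z (or_intror Vz).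
  by have := disj z Uz Vz.
have hh : involutive h.
  move=> z; have [Uz|nUz] := pselect (U z \/ V z); last by rewrite !hid.
  by apply: rh; apply: r_sym; exact: hr.
have hsim z D n : D \in L n -> U z \/ V z -> (D z <-> D (h z)).
  by move=> LD /hr[_]; apply; exact: LD.
(* Paired points lie in the same listed sets, so the preimage of [A] within [U] is the trace on [U]
   of a [D] representing [A] on [V]. *)
have preU A n D : D \in L n -> V `&` D = V `&` A -> U `&` (h @^-1` A) = U `&` D.
  move=> LD DA; apply/seteqP; split=> z /= [Uz Hz]; split=> //.
    apply/(hsim z D n LD (or_introl Uz)).
    by have [] : (V `&` D) (h z) by rewrite DA; split=> //; exact: hU.
  have [] // : (V `&` A) (h z).
  by rewrite -DA; split; [exact: hU|exact/(hsim z D n LD (or_introl Uz))].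
have preV A n D : D \in L n -> U `&` D = U `&` A -> V `&` (h @^-1` A) = V `&` D.
  move=> LD DA; apply/seteqP; split=> z /= [Vz Hz]; split=> //.
    apply/(hsim z D n LD (or_intror Vz)).
    by have [] : (U `&` D) (h z) by rewrite DA; split=> //; exact: hV.
  have [] // : (U `&` A) (h z).
  by rewrite -DA; split; [exact: hV|exact/(hsim z D n LD (or_intror Vz))].
pose S := U `|` V.
have cS : clopen S := clopenU cU cV.
have preS A : h @^-1` A `\` S = A `\` S.
  by apply/seteqP; split=> z /= [Az nSz]; move: Az; rewrite (hid z nSz).
have split_S A : S `&` A = (U `&` A) `|` (V `&` A) by rewrite setIUl.
have hcl A : clopen A -> clopen (h @^-1` A).
  move=> cA; rewrite -(setUIDK (h @^-1` A) S).
  have [n [D [LD DA]]] := LU A cA; have [m [E [LE EA]]] := LV A cA.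
  rewrite preS setIC split_S (preU A m E LE EA) (preV A n D LD DA).
  apply: clopenU; last exact: clopenD.
  by apply: clopenU; apply: clopenI => //; [exact: cL LE|exact: cL LD].
have hc : continuous h by exact: continuous_clopen.
have mS A : clopen A -> mu (S `&` A) = mu (U `&` A) + mu (V `&` A).
  move=> cA; have cUA := clopenI cU cA; have cVA := clopenI cV cA.
  rewrite split_S measureU//; [exact: clopen_borel..|].
  by rewrite -subset0 => z [[Uz _] [Vz _]]; exact: disj Vz.
(* The two contributions are exchanged: the preimage has in [U] the measure that [A] has in [V], and
   conversely. *)
have hmeasure A : clopen A -> mu (S `&` (h @^-1` A)) = mu (S `&` A).
  move=> cA; rewrite !mS//; last exact: hcl.
  have [n [D [LD DA]]] := LU A cA; have [m [E [LE EA]]] := LV A cA.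
  rewrite (preU A m E LE EA) (preV A n D LD DA) -DA -EA.
  rewrite (matched_mem_measure (cL m) cU cV (mL m) LE).
  by rewrite -(matched_mem_measure (cL n) cU cV (mL n) LD) addeC.
have rxy : r x y.
  by split; [left|move=> n D; exact: matched_code_pt (mL n) Ux D].
exists h; split; [|exact: rh|exact/rh/r_sym].
split; first by exists h.
have mh : measurable_fun [set: borel X] (h : borel X -> borel X).
  apply: (@measurability _ _ (borel X) (borel X) _ h (@open X)) => // _ [B oB <-].
  by rewrite setTI; apply: open_borel; move/continuousP : hc; exact.
have Soo : mu S < +oo.
  by rewrite -(setIT S) mS ?setIT; [rewrite -UV lte_add_pinfty|exact: clopenT].
have bS := clopen_borel cS.
(* The restriction of [mu] to [S] is finite and agrees with its image under [h] on clopen sets,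
   hence on Borel sets. *)
have eqS A : measurable (A : set (borel X)) -> mu (A `&` S) = mu (h @^-1` A `&` S).
  pose m1 : borel_measure R X := mrestr mu bS.
  (* Named explicitly: [mh] cannot be inferred from [pushforward m1 h]. *)
  pose m2 : borel_measure R X :=
    measure_function_pushforward__canonical__measure_function_Measure m1 mh.
  have m12 B : measurable (B : set (borel X)) -> m1 B = m2 B; last exact: m12.
  apply: (measure_eq_clopen hX zX cX rC).
    by change (mu (setT `&` S) < +oo); rewrite setTI.
  move=> {}B cB; change (mu (B `&` S) = mu (h @^-1` B `&` S)).
  by rewrite !(setIC _ S) hmeasure.
move=> A mA.
have mhA : measurable (h @^-1` A : set (borel X)).
  by rewrite -[X in measurable X]setTI; exact: mh.
rewrite (measureDI mu mhA bS) (measureDI mu mA bS) preS; congr (_ + _).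
exact/esym/eqS.
Qed.

(** * Non-defective points: transitivity and density *)

Lemma nondefectiveP z : ~ defective_set mu z <->
  exists U, [/\ clopen U, U z & mu U < +oo].
Proof.
split=> [nz|[U [cU Uz Uoo]] dz]; last by move: Uoo; rewrite dz.
apply: contrapT => nU; apply: nz => U cU Uz.
by apply: contrapT => /eqP; rewrite -ltey => Uoo; apply: nU; exists U.
Qed.

Lemma nondefective_transitive x y :
  ~ defective_set mu x -> ~ defective_set mu y ->
  exists2 h : X -> X, H_group mu h & h x = y.
Proof.
move=> /nondefectiveP[U [cU Ux Uoo]] /nondefectiveP[V [cV Vy Voo]].
have [->|xy] := eqVneq x y.
  by exists id => //; split=> //; exists id; split=> // z; exact: cvg_id.
(* Cutting along [A] makes the two neighbourhoods disjoint; the heavier one is then shrunk around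
   its point to the measure of the other. *)
have [A [cA Ax nAy]] := zX xy.
have cUA := clopenI cU cA; have cVA := clopenD cV cA.
have UAoo : mu (U `&` A) < +oo.
  by apply: le_lt_trans Uoo; apply: sub_measure_clopen => // z [].
have VAoo : mu (V `\` A) < +oo.
  by apply: le_lt_trans Voo; apply: sub_measure_clopen => // z [].
have [le|/ltW le] := leP (mu (U `&` A)) (mu (V `\` A)).
  have UA0 : U `&` A !=set0 by exists x.
  have [W [cW WV Wy WU]] := good_le_pt cUA cVA UA0 (conj Vy nAy) VAoo le.
  have UW0 : U `&` A `&` W = set0 by rewrite -subset0 => z [[_ Az] /WV[]].
  have [h [hH hxy _]] :=
    swap_homeomorphism cUA cW UW0 UAoo (esym WU) (conj Ux Ax) Wy.
  by exists h.
have VA0 : V `\` A !=set0 by exists y.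
have [W [cW WU Wx WV]] := good_le_pt cVA cUA VA0 (conj Ux Ax) UAoo le.
have VW0 : (V `\` A) `&` W = set0 by rewrite -subset0 => z [[_ nAz] /WU[]].
have [h [hH _ hxy]] :=
  swap_homeomorphism cVA cW VW0 VAoo (esym WV) (conj Vy nAy) Wx.
by exists h.
Qed.

Lemma dense_nondefective : mu (defective_set mu) = 0 ->
  dense (~` defective_set mu).
Proof.
move=> mu0 O O0 oO; apply: contrapT => nO.
have OD : O `<=` defective_set mu.
  by move=> z Oz; apply: contrapT => nz; apply: nO; exists z.
have : mu O <= mu (defective_set mu).
  apply: le_measure => //; rewrite inE; first exact: open_borel.
  (* The defective set is closed: a clopen set of finite measure around [z] contains no defective
     point. *)
  apply: closed_borel; rewrite -openC openE => z nz.
  have /nondefectiveP[U [cU Uz Uoo]] := nz.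
  rewrite /interior; apply: filterS (open_nbhs_nbhs (conj cU.1 Uz)) => t Ut dt.
  by move: Uoo; rewrite dt.
by rewrite mu0 leNgt mu_full.
Qed.

End GoodMeasure.

Theorem corollary2p14 (R : realType) (X : pmetricType R)
    (hX : cantor_like X) (mu : borel_measure R X)
    (hmu : M0_infty mu) (hgood : good mu) :
  (forall x1 x2 : X, (~` defective_set mu) x1 -> (~` defective_set mu) x2 ->
     exists2 h : X -> X, H_group mu h & h x1 = x2) /\
  topologically_transitive (H_group mu).
Proof.
have [_ cptX hausX zeroX] := hX; have [[mu_full mu_na _] mu0] := hmu.
(* A compact metric space has countably many clopen sets; [C] enumerates them. *)
have [C] := @clopen_surj R X cptX.
have rC : range C = @clopen X.
  by apply/seteqP; split=> [_ [n _ <-]|U cU]; [exact: funS|exact: (@surj _ _ _ _ C)].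
have trans x1 x2 : (~` defective_set mu) x1 -> (~` defective_set mu) x2 ->
    exists2 h : X -> X, H_group mu h & h x1 = x2.
  exact: nondefective_transitive rC hausX zeroX cptX mu_full mu_na hgood x1 x2.
split=> //.
have dn := dense_nondefective mu_full mu0.
have [x [_ nx]] : [set: X] `&` ~` defective_set mu !=set0.
  by apply: dn; [exists point|exact: openT].
exists x => O O0 oO; have [y [Oy ny]] := dn O O0 oO.
exists y; split=> //; have [h Hh hxy] := trans x y nx ny.
by exists h.
Qed.
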